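(* Let $\mathbf{s}\in\mathbb{R}^n$ with $\|\mathbf{s}\|_2=1$ be the signal to be decomposed. Let $\mathbf{v}$ be a symmetric decreasing filter of length $l'$ with $0<l'\le\lfloor\frac{n-1}{4}\rfloor$, and let $\mathbf{w}=\mathbf{v}\ast\mathbf{v}$ be another symmetric decreasing filter, of length $l$ with $0<l\le\lfloor\frac{n-1}{2}\rfloor$, defined as the convolution of $\mathbf{v}$ with itself. Let $\mathcal{BC}\in\{\mathcal{P},\mathcal{R},\mathcal{AR}\}$ denote Periodic, Reflective or Anti-Reflective boundary conditions, and let $W^{\mathcal{BC}}\in\mathbb{R}^{n\times n}$ be the structured matrix constructed from $\mathbf{w}$ and $\mathcal{BC}$, which is diagonalized by $Q^{\mathcal{BC}}$: $W^{\mathcal{BC}}=Q^{\mathcal{BC}}D^{\mathcal{BC}}(Q^{\mathcal{BC}})^{-1}$ with $D^{\mathcal{BC}}$ diagonal. Let $\zeta\in\{0,1,\ldots,n-1\}$ be the number of zero eigenvalues of $W^{\mathcal{BC}}$ (counted with multiplicity). Let $\alpha^{\mathcal{P}}=\alpha^{\mathcal{R}}=1$, $\alpha^{\mathcal{AR}}=3$ and $\beta^{\mathcal{P}}=\beta^{\mathcal{R}}=1$, $\beta^{\mathcal{AR}}=2$. (1) At step $k$ of the (first) inner loop of the Discrete Iterative Filtering (DIF) method, the first IMF is $$\mathbf{f}_1=Q^{\mathcal{BC}}(Z^{\mathcal{BC}})^k(Q^{\mathcal{BC}})^{-1}\mathbf{s},$$ where $Z^{\mathcal{BC}}=I-D^{\mathcal{BC}}$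 can be written, for a suitable permutation matrix $P$, as $$Z^{\mathcal{BC}}=P\,\mathrm{diag}\bigl(1-\lambda_1^{\mathcal{BC}},\,1-\lambda_2^{\mathcal{BC}},\ldots,1-\lambda_{n-\zeta}^{\mathcal{BC}},\,\underbrace{1,\ldots,1}_{\zeta}\bigr)P^T,$$ where $\lambda_1^{\mathcal{BC}},\ldots,\lambda_{n-\zeta}^{\mathcal{BC}}$ are the nonzero eigenvalues of $W^{\mathcal{BC}}$ and the first $\beta^{\mathcal{BC}}$ elements of this diagonal are equal to zero. (2) Letting $k\to\infty$, the first outer loop step of the DIF method converges to $$\mathbf{f}_1=Q^{\mathcal{BC}}Z_\infty(Q^{\mathcal{BC}})^{-1}\mathbf{s},$$ where $Z_\infty$ is a diagonal matrix whose entries are all zero except for $\zeta$ diagonal elements equal to one. (3) Fix $\delta>0$. For the minimum $k_0\in\mathbb{N}$ such that $$\frac{k_0^{k_0}}{(k_0+1)^{k_0+1}}<\frac{\delta}{\alpha^{\mathcal{BC}}\,\|(Q^{\mathcal{BC}})^{-1}\mathbf{s}\|_\infty\sqrt{n-\beta^{\mathcal{BC}}-\zeta}},$$ the stopping criterion $$\|\mathbf{s}^1_{k+1}-\mathbf{s}^1_k\|_2<\delta\qquad\text{for all }k\ge k_0$$ is satisfied, so that the DIF algorithm with this stopping criterion takes finitely many steps to produce the first IMF.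
   Context: Here $\mathbb{N}=\{1,2,3,\ldots\}$. Filters. A filter of length $l$ (with $0<l\le\lfloor\frac{n-1}{2}\rfloor$) is a non-negative vector $\mathbf{w}=(0,\ldots,0,w_{-l},\ldots,w_{-1},w_0,w_1,\ldots,w_l,0,\ldots,0)\in\mathbb{R}^n$ with $w_j>0$ for $j=-l,\ldots,l$ and $\sum_{j=-l}^{l}w_j=1$. It is symmetric if $w_{-j}=w_j$ for $j=1,\ldots,l$. It is decreasing if $w_i\ge w_j$ whenever $0\le i<j$, and $w_i\ge w_j$ whenever $j<i\le 0$. The convolution $\mathbf{w}=\mathbf{v}\ast\mathbf{v}$ is given by $w_k=\sum_{j}v_jv_{k-j}$ (with $v_j=0$ for $|j|>l'$), so that $l=2l'$. Boundary conditions. A signal $\mathbf{s}=(s_0,\ldots,s_{n-1})^T\in\mathbb{R}^n$ is extended to indices $-l,\ldots,n-1+l$ by setting $s^{\mathcal{BC}}_i=s_i$ for $0\le i\le n-1$ and, for $j=1,\ldots,l$: - Periodic ($\mathcal{P}$): $s^{\mathcal{P}}_{-j}=s_{n-j}$, $s^{\mathcal{P}}_{n-1+j}=s_{j-1}$; - Reflective ($\mathcal{R}$): $s^{\mathcal{R}}_{-j}=s_{j-1}$, $s^{\mathcal{R}}_{n-1+j}=s_{n-j}$; - Anti-Reflective ($\mathcal{AR}$): $s^{\mathcal{AR}}_{-j}=2s_0-s_j$, $s^{\mathcal{AR}}_{n-1+j}=2s_{n-1}-s_{n-1-j}$. Structured matrix. $W^{\mathcal{BC}}\in\mathbb{R}^{n\times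 n}$ is the matrix of the linear map $\mathbf{s}\mapsto W^{\mathcal{BC}}\mathbf{s}$ given by $(W^{\mathcal{BC}}\mathbf{s})_i=\sum_{j=i-l}^{i+l}w_{|i-j|}\,s^{\mathcal{BC}}_j$ for $i=0,\ldots,n-1$. Diagonalizing matrices (columns are eigenvectors of $W^{\mathcal{BC}}$). For $i,j=1,\ldots,n$: - $[Q^{\mathcal{P}}]_{i,j}=\frac{1}{\sqrt n}\,e^{2(i-1)(j-1)\pi\mathrm{i}/n}$, where in the exponent $\mathrm{i}$ (upright) is the imaginary unit; - $[Q^{\mathcal{R}}]_{i,j}=\sqrt{\frac{2-\delta_{j1}}{n}}\cos\left(\frac{(j-1)(2i-1)\pi}{2n}\right)$, with $\delta$ the Kronecker delta; - $Q^{\mathcal{AR}}$ is the $n\times n$ matrix whose first column is $\eta^{-1}(n-1,n-2,\ldots,1,0)^T$, whose last column is $\eta^{-1}(0,1,\ldots,n-2,n-1)^T$ with $\eta=\sqrt{\sum_{j=0}^{n-1}j^2}$, whose central block (rows and columns $2,\ldots,n-1$) is $\hat Q^{\mathcal{AR}}$ with $[\hat Q^{\mathcal{AR}}]_{i,j}=\sqrt{\frac{2}{n-1}}\sin\left(\frac{ij\pi}{n-1}\right)$ for $i,j=1,\ldots,n-2$, and whose remaining entries (first and last row, columns $2,\ldots,n-1$) are zero. DIF method, first outer step. The inner loop starts from $\mathbf{s}$ and repeatedly applies $I-W^{\mathcal{BC}}$ (the boundary conditions being reimposed at each iteration). The iterate after $k$ steps is $\mathbf{s}^1_k=(I-W^{\mathcal{BC}})^k\mathbf{s}$.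 The first IMF (Intrinsic Mode Function) at step $k$ is $\mathbf{f}_1=\mathbf{s}^1_k$, and its ideal value is the limit as $k\to\infty$. When a stopping criterion is used, the inner loop stops once the criterion is met. *)

(* Defs.v *)
From HB Require Import structures.
From mathcomp Require Import all_boot all_order all_fingroup all_algebra.
From mathcomp Require Import all_classical all_reals all_analysis.
From mathcomp Require Import complex.
Set Implicit Arguments.
Unset Strict Implicit.
Unset Printing Implicit Defensive.
Import Order.TTheory GRing.Theory Num.Theory.
Import numFieldNormedType.Exports.
Local Open Scope classical_set_scope.
Local Open Scope ring_scope.
Local Open Scope complex_scope.

Section Defs.
Variable R : realType.

(* Filters are indexed by int and vanish outside [-l, l]; the ambient dimension
   n only bounds the length l. *)
Definition is_filter (n l : nat) (w : int -> R) : Prop :=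
  [/\ (0 < l <= n.-1 %/ 2)%N,
      forall j : int, (`|j| <= l)%N -> 0 < w j,
      forall j : int, (l < `|j|)%N -> w j = 0
    & \sum_(i < (2 * l).+1) w (i%:Z - l%:Z) = 1].

Definition filter_symmetric (w : int -> R) : Prop :=
  forall j : int, w (- j) = w j.

Definition filter_decreasing (w : int -> R) : Prop :=
  (forall i j : int, 0 <= i -> i < j -> w j <= w i) /\
  (forall i j : int, j < i -> i <= 0 -> w j <= w i).

Definition sym_dec_filter (n l : nat) (w : int -> R) : Prop :=
  [/\ is_filter n l w, filter_symmetric w & filter_decreasing w].

(* w_k = \sum_j v_j u_(k-j), for v supported in [-l, l]. *)
Definition filter_conv (l : nat) (v u : int -> R) (k : int) : R :=
  \sum_(i < (2 * l).+1) v (i%:Z - l%:Z) * u (k - (i%:Z - l%:Z)).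

Inductive boundary_condition := Periodic | Reflective | AntiReflective.

(* s_k, with the junk value 0 when k >= n. *)
Definition sample n (s : 'cV[R]_n) (k : nat) : R :=
  if insub k is Some i then s i 0 else 0.

(* Index - j is Negz j.-1; index n - 1 + j is Posz k with j = k.+1 - n. *)
Definition bc_extend (bc : boundary_condition) n (s : 'cV[R]_n) (i : int) : R :=
  match i with
  | Posz k =>
      if (k < n)%N then sample s k else
      let j := (k.+1 - n)%N in
      match bc with
      | Periodic => sample s j.-1
      | Reflective => sample s (n - j)
      | AntiReflective => 2 * sample s n.-1 - sample s (n.-1 - j)
      end
  | Negz k =>
      let j := k.+1 in
      match bc with
      | Periodic => sample s (n - j)
      | Reflective => sample s j.-1
      | AntiReflective => 2 * sample s 0 - sample s j
      end
  end.

(* \sum_(j = i-l)^(i+l) w_|i-j| s_j^BC, reindexed by j = i + d - l. *)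
Definition bc_filter (bc : boundary_condition) n (l : nat) (w : int -> R)
    (s : 'cV[R]_n) : 'cV[R]_n :=
  \col_(i < n) \sum_(d < (2 * l).+1)
    let j : int := i%:Z + d%:Z - l%:Z in
    w (absz (i%:Z - j)%R) * bc_extend bc s j.

Definition bc_matrix (bc : boundary_condition) n (l : nat) (w : int -> R) :
    'M[R]_n :=
  \matrix_(i < n, j < n) bc_filter bc l w (delta_mx j 0) i 0.

Lemma sampleE n (s : 'cV[R]_n) k :
  sample s k = \sum_(j < n) s j 0 * sample (delta_mx j 0 : 'cV[R]_n) k.
Proof.
rewrite /sample; case: insubP => [i _ _|_]; last first.
  by rewrite big1 // => j _; rewrite mulr0.
rewrite (bigD1 i) //= mxE !eqxx mulr1 big1 ?addr0 // => j ji.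
by rewrite mxE eq_sym (negbTE ji) mulr0.
Qed.

Lemma bc_extendE bc n (s : 'cV[R]_n) i :
  bc_extend bc s i =
  \sum_(j < n) s j 0 * bc_extend bc (delta_mx j 0 : 'cV[R]_n) i.
Proof.
have ar a b : 2 * sample s a - sample s b = \sum_(j < n) s j 0 *
    (2 * sample (delta_mx j 0 : 'cV[R]_n) a - sample (delta_mx j 0 : 'cV[R]_n) b).
  rewrite (sampleE s a) (sampleE s b) mulr_sumr -sumrB.
  by apply: eq_bigr => j _; rewrite mulrBr mulrCA.
by case: i => k /=; [case: ifP => _|]; case: bc => //=;
  rewrite ?ar // -sampleE.
Qed.

(* bc_matrix is the matrix of the linear map bc_filter. *)
Lemma mul_bc_matrix bc n l w (s : 'cV[R]_n) :
  bc_matrix bc n l w *m s = bc_filter bc l w s.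
Proof.
apply/colP => i; rewrite !mxE.
under eq_bigr do rewrite !mxE mulr_suml.
rewrite exchange_big /=; apply: eq_bigr => d _.
rewrite bc_extendE mulr_sumr; apply: eq_bigr => j _.
by rewrite -mulrA [s j 0 * _]mulrC.
Qed.

Definition cexp (z : R[i]) : R[i] :=
  (expR (complex.Re z) * cos (complex.Im z)) +i*
  (expR (complex.Re z) * sin (complex.Im z)).

(* All indices below start from 0. *)
Definition QP n : 'M[R[i]]_n :=
  \matrix_(i < n, j < n)
    (((Num.sqrt n%:R)^-1)%:C
     * cexp (0 +i* (2 * i%:R * j%:R * pi / n%:R))).

Definition QR n : 'M[R]_n :=
  \matrix_(i < n, j < n)
    (Num.sqrt ((2 - (j == 0%N :> nat)%:R) / n%:R)
     * cos (j%:R * (2 * i%:R + 1) * pi / (2 * n%:R))).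

Definition QAR n : 'M[R]_n :=
  let eta : R := Num.sqrt (\sum_(j < n) j%:R ^+ 2) in
  \matrix_(i < n, j < n)
    if j == 0%N :> nat then (n.-1%:R - i%:R) / eta
    else if j == n.-1 :> nat then i%:R / eta
    else if (i == 0%N :> nat) || (i == n.-1 :> nat) then 0
    else Num.sqrt (2 / n.-1%:R) * sin (i%:R * j%:R * pi / n.-1%:R).

Definition toC m n (A : 'M[R]_(m, n)) : 'M[R[i]]_(m, n) :=
  map_mx (real_complex R) A.

Definition bc_Q (bc : boundary_condition) n : 'M[R[i]]_n :=
  match bc with
  | Periodic => QP n
  | Reflective => toC (QR n)
  | AntiReflective => toC (QAR n)
  end.

Definition bc_alpha (bc : boundary_condition) : R :=
  match bc with AntiReflective => 3 | _ => 1 end.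

Definition bc_beta (bc : boundary_condition) : nat :=
  match bc with AntiReflective => 2 | _ => 1 end.

(* The norm that the library puts on matrices is the sup norm. *)
Definition norm2 n (x : 'cV[R]_n) : R := Num.sqrt (\sum_(i < n) x i 0 ^+ 2).

Definition norm_inf n (x : 'cV[R[i]]_n) : R :=
  \big[Num.max/0]_(i < n) ComplexField.Normc.normc (x i 0).

Definition num_zero_eigenvalues n (W : 'M[R]_n) : nat := mup 0 (char_poly W).

Definition dif_step n (W : 'M[R]_n) (x : 'cV[R]_n) : 'cV[R]_n :=
  (1%:M - W) *m x.

Definition dif_iter n (W : 'M[R]_n) (s : 'cV[R]_n) (k : nat) : 'cV[R]_n :=
  iter k (dif_step W) s.

(* [dif_inner_loop W delta x m f]: started from x, the inner loop with stopping
   criterion ||x_(k+1) - x_k||_2 < delta halts after m steps and returns f. *)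
Inductive dif_inner_loop n (W : 'M[R]_n) (delta : R) :
    'cV[R]_n -> nat -> 'cV[R]_n -> Prop :=
| dif_stop x :
    norm2 (dif_step W x - x) < delta -> dif_inner_loop W delta x 0 x
| dif_continue x m f :
    delta <= norm2 (dif_step W x - x) ->
    dif_inner_loop W delta (dif_step W x) m f ->
    dif_inner_loop W delta x m.+1 f.

End Defs.

(* Main.v *)
Require Import Defs.
From HB Require Import structures.
From mathcomp Require Import all_boot all_order all_fingroup all_algebra.
From mathcomp Require Import all_classical all_reals all_analysis.
From mathcomp Require Import complex.
From mathcomp Require Import zify ring lra.
Set Implicit Arguments.
Unset Strict Implicit.
Unset Printing Implicit Defensive.
Import Order.TTheory GRing.Theory Num.Theory.
Import numFieldNormedType.Exports.
Local Open Scope classical_set_scope.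
Local Open Scope ring_scope.
Local Open Scope complex_scope.

(** Let v have length l and let hat v(t) = sum_j v_j cos (j t) be its symbol;
it is real because v is even. Three facts carry the theorem.

The filter w = v * v has symbol hat w = (hat v)^2 ([symbol_conv]), and
|hat v| <= 1 since v is nonnegative of mass 1. An even filter maps the sequence
cos (t i + phi) to hat w(t) times itself ([wsum_cos]), and fixes affine
sequences. So a sampled cosine or affine sequence is an eigenvector of the
structured matrix as soon as the boundary rule reproduces the sequence beyond
the ends of the signal. This holds for the columns of each of the three
matrices Q, at the angles 2 pi j / n, pi j / n and pi j / (n - 1) (with
eigenvalue 1 for the two affine columns of the anti-reflective case). Hence
every eigenvalue lies in [0, 1]. The angle with j = 1 is so small that all the
cosines in its symbol are positive; thus there is a nonzero eigenvalue besides
the beta ones that are known to equal 1, and n - beta - zeta > 0.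

Apart from the two affine columns, the columns of Q are orthonormal. This
follows from the product formulas and from the telescoping sum of cosines in
arithmetic progression ([sum_cos_progression]).

What remains is spectral and common to the three cases ([dif_spectrum]). In the
eigenbasis the k-th power of I - W multiplies the j-th coordinate by
(1 - lambda_j)^k, which converges to 1 if lambda_j = 0 and to 0 otherwise. The
step from k to k + 1 multiplies it by - lambda_j (1 - lambda_j)^k, which is zero
for the beta special columns when k > 0 and whenever lambda_j = 0. At most
n - beta - zeta coordinates survive, along orthonormal columns, and each factor
is at most k^k / (k + 1)^(k + 1) by the inequality between arithmetic and
geometric means ([power_gap_bound]). As alpha >= 1, this gives the stopping
criterion. *)

(** * Filters and their symbols *)

Section WindowSums.
Variable R : realType.
Implicit Types (v w F G : int -> R) (L a l : nat).

Definition wsum L F : R := \sum_(i < (2 * L).+1) F (i%:Z - L%:Z).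

Lemma eq_wsum L F G : (forall j : int, (`|j| <= L)%N -> F j = G j) ->
  wsum L F = wsum L G.
Proof. by move=> FG; apply: eq_bigr => i _; apply: FG; have := ltn_ord i; lia. Qed.

Lemma wsumN L F : wsum L (fun j => F (- j)) = wsum L F.
Proof.
rewrite /wsum (reindex_inj rev_ord_inj) /=; apply: eq_bigr => i _.
by congr F; have := ltn_ord i; lia.
Qed.

(** A window that covers the translated support sees the whole sum, so finite
window sums can be translated as if they ran over all integers. *)
Lemma wsum_shift a L F (m : int) :
  (forall j : int, (a < `|j|)%N -> F j = 0) -> (a + `|m| <= L)%N ->
  wsum L (fun j => F (j + m)) = wsum a F.
Proof.
move=> F0 aL; rewrite /wsum.
pose t := absz (L%:Z - m - a%:Z)%R.
have tE : t%:Z = L%:Z - m - a%:Z by lia.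
(* only the 2a + 1 indices from t on meet the support *)
rewrite -(big_mkord xpredT (fun i : nat => F (i%:Z - L%:Z + m))).
rewrite (@big_cat_nat _ _ _ t) //=; last lia.
rewrite big_nat big1 ?add0r => [|i /andP[_ it]]; last by apply: F0; lia.
rewrite (@big_cat_nat _ _ _ (t + (2 * a).+1)) //=; [|lia|lia].
rewrite [X in _ + X]big_nat [X in _ + X]big1 ?addr0 => [|i /andP[it _]]; last first.
  by apply: F0; lia.
rewrite -{1}[t]add0n big_addn addKn big_mkord.
by apply: eq_bigr => i _; congr F; lia.
Qed.

Lemma exchange_wsum L a (F : int -> int -> R) :
  wsum L (fun k => wsum a (F k)) = wsum a (fun j => wsum L (F^~ j)).
Proof. exact: exchange_big. Qed.

Lemma wsumZ L c F : wsum L (fun j => c * F j) = c * wsum L F.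
Proof. by rewrite /wsum mulr_sumr. Qed.

Lemma wsumD L F G : wsum L (fun j => F j + G j) = wsum L F + wsum L G.
Proof. exact: big_split. Qed.

Lemma wsum_odd L F : (forall j, F (- j) = - F j) -> wsum L F = 0.
Proof.
move=> oF; have : wsum L F = - wsum L F.
  rewrite -{1}wsumN -mulN1r -wsumZ; apply: eq_wsum => j _.
  by rewrite oF mulN1r.
lra.
Qed.

Lemma filter_convE l v w k :
  filter_conv l v w k = wsum l (fun j => v j * w (k - j)).
Proof. by []. Qed.

(** The discrete Fourier transform of an even filter supported in [-l, l]. *)
Definition symbol l w (theta : R) : R :=
  wsum l (fun j => w j * cos (theta * j%:~R)).

(** By the addition formula, up to a sine part that is odd in the filter index
and cancels. *)
Lemma wsum_cos l w theta phi : filter_symmetric w ->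
  wsum l (fun j => w j * cos (theta * j%:~R + phi)) = symbol l w theta * cos phi.
Proof.
move=> sw.
have -> : wsum l (fun j => w j * cos (theta * j%:~R + phi)) =
    wsum l (fun j => cos phi * (w j * cos (theta * j%:~R)))
    + wsum l (fun j => - sin phi * (w j * sin (theta * j%:~R))).
  by rewrite -wsumD; apply: eq_wsum => j _; rewrite cosD; ring.
rewrite !wsumZ [X in _ + _ * X]wsum_odd ?mulr0 ?addr0 1?mulrC // => j.
by rewrite sw mulrNz mulrN sinN mulrN.
Qed.

(** The convolution theorem; the squared symbol is what makes the eigenvalues
nonnegative. *)
Lemma symbol_conv l v theta : filter_symmetric v ->
  (forall j : int, (l < `|j|)%N -> v j = 0) ->
  symbol (2 * l) (filter_conv l v v) theta = symbol l v theta ^+ 2.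
Proof.
move=> sv v0; rewrite /symbol.
transitivity (wsum (2 * l) (fun k => wsum l (fun j =>
    v j * (v (k - j) * cos (theta * k%:~R))))).
  by apply: eq_wsum => k _; rewrite mulrC filter_convE -wsumZ;
     apply: eq_wsum => j _; ring.
rewrite exchange_wsum expr2 -{1}wsumZ; apply: eq_wsum => j jl.
rewrite wsumZ mulrCA; congr (_ * _).
rewrite -[X in _ = X * _]/(symbol l v theta) -wsum_cos //.
rewrite -(@wsum_shift l (2 * l) _ (- j)).
- by apply: eq_wsum => k _; rewrite -mulrDr -intrD subrK.
- by move=> m lm; rewrite v0 ?mul0r.
- by lia.
Qed.

Lemma symbol0 l w : symbol l w 0 = wsum l w.
Proof. by apply: eq_wsum => j _; rewrite mul0r cos0 mulr1. Qed.

Section Filter.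
Variables (n l : nat) (v : int -> R).
Hypothesis hv : sym_dec_filter n l v.

Let v_sym : filter_symmetric v. Proof. by case: hv. Qed.
Let v_sum : wsum l v = 1. Proof. by case: hv => -[]. Qed.
Let v_out (j : int) : (l < `|j|)%N -> v j = 0.
Proof. by case: hv => -[_ _ + _] _ _; exact. Qed.
Let v_gt0 (j : int) : (`|j| <= l)%N -> 0 < v j.
Proof. by case: hv => -[_ + _ _] _ _; exact. Qed.

Lemma filter_ge0 (j : int) : 0 <= v j.
Proof. by have [/v_gt0/ltW//|/v_out->] := leqP `|j| l. Qed.

Lemma filter_le_abs (i j : int) : (`|i| <= `|j|)%N -> v j <= v i.
Proof.
have vabs (k : int) : v k = v `|k|%N by case: (intP k) => // m; rewrite v_sym abszN.
rewrite (vabs i) (vabs j) leq_eqVlt => /predU1P[->//|ij].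
by case: hv => _ _ [+ _]; apply; lia.
Qed.

Lemma norm_symbol_le1 theta : `|symbol l v theta| <= 1.
Proof.
rewrite -v_sum; apply: (le_trans (ler_norm_sum _ _ _)); apply: ler_sum => i _.
rewrite normrM (ger0_norm (filter_ge0 _)) ler_piMr ?filter_ge0 //.
by rewrite ler_norml cos_geN1 cos_le1.
Qed.

(** Every angle in the sum stays within a quarter turn of 0. *)
Lemma symbol_gt0 theta : 0 <= theta -> theta * l%:R < pi / 2 ->
  0 < symbol l v theta.
Proof.
move=> t0 tl; have pos (i : 'I_(2 * l).+1) :
    0 < v (i%:Z - l%:Z) * cos (theta * (i%:Z - l%:Z)%:~R).
  have il : (`|i%:Z - l%:Z| <= l)%N by have := ltn_ord i; lia.
  apply: mulr_gt0; first exact: v_gt0.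
  apply: cos_gt0_pihalf; rewrite -ltr_norml normrM (ger0_norm t0).
  apply: le_lt_trans (ler_wpM2l t0 _) tl.
  by rewrite -intr_norm -[l%:R]/(l%:Z%:~R) ler_int; lia.
rewrite /symbol /wsum big_ord_recl; apply: ltr_wpDr (pos ord0).
by apply: sumr_ge0 => i _; exact/ltW/pos.
Qed.

Let w := filter_conv l v v.

Lemma filter_conv_symmetric : filter_symmetric w.
Proof.
move=> k; rewrite /w !filter_convE -wsumN; apply: eq_wsum => j _.
by rewrite v_sym -(v_sym (- k - _)); congr (_ * v _); lia.
Qed.

Lemma filter_conv_window L (k : int) : (l <= L)%N ->
  w k = wsum L (fun j => v j * v (k - j)).
Proof.
move=> lL; rewrite /w filter_convE -(@wsum_shift l L _ 0) ?addn0 //; last first.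
  by move=> j lj; rewrite v_out ?mul0r.
by apply: eq_wsum => j _; rewrite addr0.
Qed.

(** The window of m |-> (v_m - v_(m+1)) v_(k-m) is folded by the involution
m |-> - 1 - m, which changes the sign of the first factor as v is even. *)
Lemma filter_conv_diff (k : nat) :
  w k - w k.+1 =
  \sum_(m < l.+1) (v m - v m.+1) * (v (k%:Z - m%:Z) - v (k%:Z + m.+1%:Z)).
Proof.
have -> : w k.+1 = wsum l.+1 (fun m => v (m + 1) * v (k%:Z - m)).
  rewrite /w filter_convE -(@wsum_shift l l.+1 _ 1); first 1 last.
  - by move=> j lj; rewrite v_out ?mul0r.
  - by rewrite addn1.
  by apply: eq_wsum => j _; congr (_ * v _); lia.
rewrite (@filter_conv_window l.+1) // /wsum -sumrB.
pose d (m : int) := (v m - v (m + 1)) * v (k%:Z - m).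
transitivity (\sum_(0 <= i < (2 * l.+1).+1) d (i%:Z - l.+1%:Z)).
  by rewrite big_mkord; apply: eq_bigr => i _; rewrite /d; ring.
(* the index l + 1 contributes 0; those from - l - 1 to l are folded at - 1 / 2 *)
rewrite (@big_cat_nat _ _ _ l.+1) //=; last lia.
rewrite [X in _ + X]big_nat_recr /=; last lia.
have -> : d ((2 * l.+1)%N%:Z - l.+1%:Z) = 0.
  rewrite (_ : (2 * l.+1)%N%:Z - _ = l.+1); last lia.
  by rewrite /d (v_out (j := l.+1)) ?(v_out (j := l.+1%:Z + 1)) ?subr0 ?mul0r //; lia.
rewrite addr0 [X in _ + X](@big_addn _ _ _ 0 _ l.+1).
have -> : (2 * l.+1 - l.+1 = l.+1)%N by lia.
rewrite !big_mkord (reindex_inj rev_ord_inj) /= -big_split /=.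
apply: eq_bigr => m _; rewrite /d.
have -> : (l.+1 - m.+1)%N%:Z - l.+1%:Z = - m.+1%:Z by have := ltn_ord m; lia.
have -> : (m + l.+1)%N%:Z - l.+1%:Z = m by lia.
have -> : - m.+1%:Z + 1 = - m%:Z by lia.
rewrite !v_sym opprK (_ : m%:Z + 1 = m.+1) ; last lia.
ring.
Qed.

(** Each term of [filter_conv_diff] is a product of nonnegative factors, as
|k - m| <= k + m + 1. *)
Lemma filter_conv_nonincreasing (i j : nat) : (i <= j)%N -> w j <= w i.
Proof.
move=> ij; rewrite -(subnK ij); elim: (j - i)%N => [//|k]; apply: le_trans.
rewrite addSn -subr_ge0 filter_conv_diff sumr_ge0 // => m _.
by rewrite mulr_ge0 // subr_ge0 filter_le_abs //; lia.
Qed.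

(** The index k, of size at most 2l, splits into two indices of size at most l. *)
Lemma filter_conv_gt0 (k : int) : (`|k| <= 2 * l)%N -> 0 < w k.
Proof.
move=> kl; rewrite /w filter_convE.
have [j [jl kjl]] : exists j : 'I_(2 * l).+1,
    (`|(j%:Z - l%:Z)%R| <= l)%N /\ (`|(k - (j%:Z - l%:Z))%R| <= l)%N.
  have [k0|k0] := leP 0 k.
    have jP : (l + minn l `|k| < (2 * l).+1)%N by lia.
    by exists (Ordinal jP) => /=; lia.
  have jP : (l - minn l `|k| < (2 * l).+1)%N by lia.
  by exists (Ordinal jP) => /=; lia.
rewrite /wsum (bigD1 j) //=; apply: ltr_wpDr.
  by apply: sumr_ge0 => i _; rewrite mulr_ge0 // filter_ge0.
by rewrite mulr_gt0 // v_gt0.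
Qed.

(** The value at 0 of the convolution theorem. *)
Lemma filter_conv_sum : wsum (2 * l) w = 1.
Proof. by rewrite -symbol0 symbol_conv // symbol0 v_sum expr1n. Qed.

Lemma filter_conv_sym_dec m : (0 < 2 * l <= m.-1 %/ 2)%N ->
  sym_dec_filter m (2 * l) w.
Proof.
move=> lm; split; [split => // | exact: filter_conv_symmetric | ].
- exact: filter_conv_gt0.
- move=> k lk; rewrite /w filter_convE /wsum big1 // => j _.
  have [jl|/v_out->] := leqP `|(j%:Z - l%:Z)%R| l; last by rewrite mul0r.
  by rewrite [X in _ * X]v_out ?mulr0 //; lia.
- exact: filter_conv_sum.
have wabs (k : int) : w k = w `|k|%N.
  by case: (intP k) => // p; rewrite filter_conv_symmetric abszN.
by split=> i j *; rewrite (wabs i) (wabs j) filter_conv_nonincreasing //; lia.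
Qed.

End Filter.
End WindowSums.

(** * Sampled eigenfunctions of the structured matrices *)

Section Eigenvectors.
Variable R : realType.
Implicit Types (f w : int -> R) (n l : nat).

Definition sampling n f : 'cV[R]_n := \col_(i < n) f i.

Lemma sample_sampling n f k : (k < n)%N -> sample (sampling n f) k = f k.
Proof. by move=> kn; rewrite /sample insubT mxE. Qed.

(** Once the boundary rule continues a sampled sequence by its own values, the
matrix acts on the sample as the filter acts on the sequence. *)
Lemma bc_matrix_eigen bc n l w f (x : R) : filter_symmetric w ->
  (forall i : int, - l%:Z <= i < n%:Z + l%:Z ->
     bc_extend bc (sampling n f) i = f i) ->
  (forall i : int, wsum l (fun d => w d * f (i + d)) = x * f i) ->
  bc_matrix bc n l w *m sampling n f = x *: sampling n f.
Proof.
move=> sw fE fx; rewrite mul_bc_matrix; apply/colP => i; rewrite !mxE -fx.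
apply: eq_bigr => d _ /=; rewrite fE; last first.
  by have := ltn_ord i; have := ltn_ord d; lia.
rewrite addrA; congr (_ * _).
have wabs (k : int) : w `|k|%N = w k by case: (intP k) => // m; rewrite sw abszN.
by rewrite wabs -sw; congr w; lia.
Qed.

Lemma wsum_cos_eigen l w (theta phi : R) (i : int) : filter_symmetric w ->
  wsum l (fun d => w d * cos (theta * (i + d)%:~R + phi))
  = symbol l w theta * cos (theta * i%:~R + phi).
Proof.
move=> sw; rewrite -wsum_cos //; apply: eq_wsum => d _.
by congr (_ * cos _); rewrite intrD; ring.
Qed.

Lemma bc_matrix_cos bc n l w (theta phi : R) : filter_symmetric w ->
  let f (i : int) := cos (theta * i%:~R + phi) in
  (forall i : int, - l%:Z <= i < n%:Z + l%:Z ->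
     bc_extend bc (sampling n f) i = f i) ->
  bc_matrix bc n l w *m sampling n f = symbol l w theta *: sampling n f.
Proof.
by move=> sw f fE; apply: bc_matrix_eigen => // i; exact: wsum_cos_eigen.
Qed.

(** The first moment of an even filter vanishes. *)
Lemma bc_matrix_affine bc n l w (a b : R) : filter_symmetric w ->
  wsum l w = 1 ->
  let f (i : int) := a * i%:~R + b in
  (forall i : int, - l%:Z <= i < n%:Z + l%:Z ->
     bc_extend bc (sampling n f) i = f i) ->
  bc_matrix bc n l w *m sampling n f = sampling n f.
Proof.
move=> sw w1 f fE; rewrite -[RHS]scale1r; apply: bc_matrix_eigen => // i.
rewrite mul1r; have -> : wsum l (fun d => w d * f (i + d)) =
    wsum l (fun d => f i * w d) + wsum l (fun d => a * (w d * d%:~R)).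
  by rewrite -wsumD; apply: eq_wsum => d _; rewrite /f intrD; ring.
rewrite !wsumZ w1 [X in _ + _ * X]wsum_odd ?mulr0 ?mulr1 ?addr0 // => d.
by rewrite sw mulrNz mulrN.
Qed.

(** The next three lemmas turn each boundary rule into symmetries of the
sampled sequence: a translation, two reflections about half-integers, and two
point reflections about the end samples. *)
Lemma bc_extend_periodic n l f : (l <= n)%N ->
  (forall i, f (i + n%:Z) = f i) ->
  forall i : int, - l%:Z <= i < n%:Z + l%:Z ->
    bc_extend Periodic (sampling n f) i = f i.
Proof.
move=> ln fn [k|k] kP /=.
  case: ifP => kn; first by rewrite sample_sampling.
  by rewrite sample_sampling -1?fn; [congr f|]; lia.
by rewrite sample_sampling -1?(fn (Negz k)); [congr f|]; lia.
Qed.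

Lemma bc_extend_reflective n l f : (l <= n)%N ->
  (forall i, f (-1 - i) = f i) -> (forall i, f ((2 * n)%N%:Z - 1 - i) = f i) ->
  forall i : int, - l%:Z <= i < n%:Z + l%:Z ->
    bc_extend Reflective (sampling n f) i = f i.
Proof.
move=> ln f0 fn [k|k] kP /=.
  case: ifP => kn; first by rewrite sample_sampling.
  by rewrite sample_sampling -1?fn; [congr f|]; lia.
by rewrite sample_sampling -1?f0; [congr f|]; lia.
Qed.

Lemma bc_extend_antireflective n l f : (l < n)%N ->
  (forall i, f (- i) = 2 * f 0 - f i) ->
  (forall i, f ((2 * n.-1)%N%:Z - i) = 2 * f n.-1 - f i) ->
  forall i : int, - l%:Z <= i < n%:Z + l%:Z ->
    bc_extend AntiReflective (sampling n f) i = f i.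
Proof.
move=> ln f0 fn [k|k] kP /=.
  case: ifP => kn; first by rewrite sample_sampling.
  rewrite !sample_sampling; [|lia|lia].
  by rewrite -fn; congr f; lia.
rewrite !sample_sampling; [|lia|lia].
by rewrite -f0.
Qed.

End Eigenvectors.

(** * Trigonometric sums *)

Section TrigSums.
Variable R : realType.
Implicit Types (x t phi : R) (m k : int) (n N : nat).

Lemma cosD2intpi x k : cos (x + k%:~R * (2 * pi)) = cos x.
Proof.
have cosn (p : nat) (y : R) : cos (y + p%:R * (2 * pi)) = cos y.
  by rewrite (mulr_natl pi 2) mulr_natl (periodicn (@cosD2pi R)).
case: (intP k) => [|p|p]; rewrite ?mul0r ?addr0 ?cosn //.
by rewrite -(cosn p.+1) mulrNz mulNr subrK.
Qed.

Lemma sinD2intpi x k : sin (x + k%:~R * (2 * pi)) = sin x.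
Proof. by rewrite -!cosBpihalf addrAC cosD2intpi. Qed.

Lemma sin_intpi k : sin (k%:~R * pi) = 0 :> R.
Proof.
have /(congr1 sin) : - (k%:~R * pi) + k%:~R * (2 * pi) = k%:~R * pi :> R by ring.
rewrite sinD2intpi sinN; lra.
Qed.

Lemma sin_fracpi_neq0 m N : (0 < `|m| < N)%N ->
  sin (m%:~R * pi / N%:R) != 0 :> R.
Proof.
move=> /andP[m0 mN].
have N0 : 0 < N%:R :> R by rewrite ltr0n; lia.
have pos (p : nat) : (0 < p < N)%N -> 0 < sin (p%:R * pi / N%:R) :> R.
  move=> /andP[p0 pN]; apply: sin_gt0_pi.
  rewrite divr_gt0 // ?mulr_gt0 ?pi_gt0 ?ltr0n //=.
  by rewrite ltr_pdivrMr // mulrC ltr_pM2l ?pi_gt0 // ltr_nat.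
case: (intP m) m0 mN => [|q|q] q0 qN; first by []; first by rewrite gt_eqF // pos; lia.
by rewrite mulrNz !mulNr sinN oppr_eq0 gt_eqF // pos; lia.
Qed.

(** The product of each term with 2 sin t is a difference of two sines, and
the sum telescopes. *)
Lemma sum_cos_progression t phi n :
  2 * sin t * \sum_(i < n) cos (phi + i%:R * (2 * t)) =
  sin (phi + (2 * n%:R - 1) * t) - sin (phi - t).
Proof.
elim: n => [|n IH].
  by rewrite big_ord0 !mulr0 sub0r mulN1r subrr.
rewrite big_ord_recr mulrDr {}IH /=.
have -> : phi + (2 * n%:R - 1) * t = phi + n%:R * (2 * t) - t by ring.
have -> : phi + (2 * n.+1%:R - 1) * t = phi + n%:R * (2 * t) + t.
  by rewrite -natr1; ring.
by rewrite (sinB (phi + _)) (sinD (phi + _)); ring.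
Qed.

Lemma sum_cos_period m n phi : (0 < `|m| < n)%N ->
  \sum_(i < n) cos (phi + i%:R * (2 * (m%:~R * pi / n%:R))) = 0.
Proof.
move=> mn; have n0 : n%:R != 0 :> R by rewrite pnatr_eq0; lia.
have := sum_cos_progression (m%:~R * pi / n%:R) phi n.
rewrite (_ : phi + _ = phi - m%:~R * pi / n%:R + m%:~R * (2 * pi)); last by field.
rewrite sinD2intpi subrr => /eqP; rewrite !mulf_eq0 pnatr_eq0 /=.
by rewrite (negbTE (sin_fracpi_neq0 mn)) => /eqP.
Qed.

Lemma sum_cos_midpoints m n : (0 < `|m| < 2 * n)%N ->
  \sum_(i < n) cos (m%:~R * (2 * i%:R + 1) * pi / (2 * n%:R)) = 0 :> R.
Proof.
move=> mn; have n0 : n%:R != 0 :> R by rewrite pnatr_eq0; lia.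
pose t : R := m%:~R * pi / (2 * n)%:R.
have := sum_cos_progression t t n.
rewrite (_ : t + (2 * n%:R - 1) * t = m%:~R * pi); last by rewrite /t natrM; field.
rewrite sin_intpi subrr sin0 subr0 => /eqP; rewrite !mulf_eq0 pnatr_eq0 /=.
rewrite (negbTE (sin_fracpi_neq0 mn)) => /eqP s0; rewrite -[RHS]s0.
by apply: eq_bigr => i _; congr cos; rewrite /t natrM; field.
Qed.

Lemma sum_cos_endpoints m N : (0 < `|m| < 2 * N)%N ->
  \sum_(i < N) cos (m%:~R * i%:R * pi / N%:R) = (1 - cos (m%:~R * pi)) / 2 :> R.
Proof.
move=> mN; have N0 : N%:R != 0 :> R by rewrite pnatr_eq0; lia.
pose t : R := m%:~R * pi / (2 * N)%:R.
have st0 : sin t != 0 by exact: sin_fracpi_neq0.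
have := sum_cos_progression t 0 N.
rewrite (_ : 0 + (2 * N%:R - 1) * t = m%:~R * pi - t); last first.
  by rewrite /t natrM; field.
rewrite sub0r sinN (sinB (m%:~R * pi)) sin_intpi => sE.
apply: (mulfI (_ : 2 * sin t != 0)); first by rewrite mulf_neq0 ?pnatr_eq0.
rewrite (_ : \sum_(i < N) _ = \sum_(i < N) cos (0 + i%:R * (2 * t))).
  by rewrite sE; field.
by apply: eq_bigr => i _; congr cos; rewrite /t natrM; field.
Qed.

Lemma cosM_prod x t : cos x * cos t = (cos (x - t) + cos (x + t)) / 2.
Proof. by rewrite cosB cosD; field. Qed.

Lemma sinM_prod x t : sin x * sin t = (cos (x - t) - cos (x + t)) / 2.
Proof. by rewrite cosB cosD; field. Qed.

End TrigSums.

Section Orthonormality.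
Variable R : realType.

Lemma QR_orthonormal n (i j : 'I_n) :
  \sum_(k < n) QR R n k i * QR R n k j = (i == j)%:R.
Proof.
have n0 : 0 < n%:R :> R by rewrite ltr0n; have := ltn_ord i; lia.
pose c (p : int) : R := \sum_(k < n) cos (p%:~R * (2 * k%:R + 1) * pi / (2 * n%:R)).
pose a (p : nat) : R := Num.sqrt ((2 - (p == 0%N)%:R) / n%:R).
have -> : \sum_(k < n) QR R n k i * QR R n k j =
    a i * a j * ((c (i%:Z - j%:Z) + c (i%:Z + j%:Z)) / 2).
  rewrite /c -big_split /= mulr_suml mulr_sumr; apply: eq_bigr => k _.
  rewrite !mxE mulrACA cosM_prod; congr (_ * ((cos _ + cos _) / _)).
    by rewrite rmorphB /=; ring.
  by rewrite rmorphD /=; ring.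
have c0 : c 0 = n%:R.
  rewrite /c; under eq_bigr do rewrite !mul0r cos0.
  by rewrite sumr_const card_ord.
have [<-|ij] := eqVneq i j.
  rewrite subrr c0 /a -expr2 sqr_sqrtr ?divr_ge0 ?(ltW n0) //; last first.
    by rewrite subr_ge0; case: (_ == _) => /=; lra.
  have [-> /=|i0] := eqVneq (i : nat) 0%N; first by rewrite c0; field; rewrite gt_eqF.
  rewrite [c (_ + _)]sum_cos_midpoints /=; last by have := ltn_ord i; lia.
  by field; rewrite gt_eqF.
have {}ij : (i : nat) != j by [].
rewrite [c (_ - _)]sum_cos_midpoints ?[c (_ + _)]sum_cos_midpoints.
- by rewrite addr0 mul0r mulr0.
- by have := ltn_ord i; have := ltn_ord j; lia.
by have := ltn_ord i; have := ltn_ord j; lia.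
Qed.

(** The zeros imposed on the first and last row are values of the sine, so a
single formula holds on the whole column. *)
Lemma QAR_interior n (k j : 'I_n) : (0 < j < n.-1)%N ->
  QAR R n k j = Num.sqrt (2 / n.-1%:R) * sin (k%:R * j%:R * pi / n.-1%:R).
Proof.
move=> /andP[j0 jn]; rewrite mxE gtn_eqF // ltn_eqF //.
have n0 : n.-1%:R != 0 :> R by rewrite pnatr_eq0; lia.
have [->|k0] /= := eqVneq (k : nat) 0%N; first by rewrite !mul0r sin0 mulr0.
case: eqVneq => [->|//]; rewrite (_ : n.-1%:R * _ * pi / _ = j%:~R * pi); last by field.
by rewrite sin_intpi mulr0.
Qed.

Lemma QAR_orthonormal n (i j : 'I_n) : (0 < i < n.-1)%N -> (0 < j < n.-1)%N ->
  \sum_(k < n) QAR R n k i * QAR R n k j = (i == j)%:R.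
Proof.
move=> iI jI; under eq_bigr do rewrite !QAR_interior //.
case: n i j iI jI => [[]//|N] i j /= /andP[i0 iN] /andP[j0 jN].
have N0 : 0 < N%:R :> R by rewrite ltr0n; lia.
have N0' : N%:R != 0 :> R by rewrite gt_eqF.
rewrite big_ord_recr /= [N%:R * i%:R]mulrC.
rewrite (_ : i%:R * N%:R * pi / _ = i%:~R * pi); last by field.
rewrite sin_intpi mulr0 mul0r addr0.
pose c (p : int) : R := \sum_(k < N) cos (p%:~R * k%:R * pi / N%:R).
transitivity (2 / N%:R * ((c (i%:Z - j%:Z) - c (i%:Z + j%:Z)) / 2)).
  rewrite /c -sumrB mulr_suml mulr_sumr; apply: eq_bigr => k _.
  rewrite mulrACA -expr2 sqr_sqrtr ?divr_ge0 ?ltW // sinM_prod.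
  congr (_ * ((cos _ - cos _) / _)).
    by rewrite rmorphB /=; field.
  by rewrite rmorphD /=; field.
(* the closed form only depends on the parity of i + j, which is that of i - j *)
have cD : c (i%:Z + j%:Z) = (1 - cos ((i%:Z - j%:Z)%:~R * pi)) / 2.
  rewrite [LHS]sum_cos_endpoints; last by lia.
  congr ((1 - _) / _); rewrite -[RHS](cosD2intpi _ j); congr cos.
  by rewrite rmorphD rmorphB /=; ring.
rewrite cD; have [<-|ij] := eqVneq i j.
  rewrite subrr mul0r cos0 subrr mul0r subr0.
  rewrite /c; under eq_bigr do rewrite !mul0r cos0.
  by rewrite sumr_const card_ord /=; field.
have {}ij : (i : nat) != j by [].
rewrite [c _]sum_cos_endpoints ?subrr ?mul0r ?mulr0 //.
by have := ltn_ord i; have := ltn_ord j; lia.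
Qed.

Lemma QP_entry n (i j : 'I_n) : let t := j%:R * (2 * pi / n%:R) * i%:R in
  QP R n i j = ((Num.sqrt n%:R)^-1)%:C * (cos t +i* sin t).
Proof.
rewrite mxE /cexp /= expR0 !mul1r.
by rewrite (_ : 2 * _ * _ * _ / _ = j%:R * (2 * pi / n%:R) * i%:R) //; ring.
Qed.

Lemma sum_complexE (I : finType) (F : I -> R[i]) :
  \sum_i F i = (\sum_i complex.Re (F i)) +i* (\sum_i complex.Im (F i)).
Proof.
elim/big_rec3: _ => // i x y z _ ->.
by case: (F i).
Qed.

Lemma QP_orthonormal n (i j : 'I_n) :
  \sum_(k < n) conjc (QP R n k i) * QP R n k j = (i == j)%:R.
Proof.
have n0 : 0 < n%:R :> R by rewrite ltr0n; have := ltn_ord i; lia.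
have n0' : n%:R != 0 :> R by rewrite gt_eqF.
transitivity (\sum_(k < n) ((n%:R : R)^-1)%:C *
    (cos ((0 : R) + k%:R * (2 * ((j%:Z - i%:Z)%:~R * pi / n%:R)))
     +i* cos (- (pi / 2 : R) + k%:R * (2 * ((j%:Z - i%:Z)%:~R * pi / n%:R))))).
  apply: eq_bigr => k _; rewrite !QP_entry (_ : conjc (_ * _) = ((Num.sqrt n%:R)^-1)%:C *
      conjc (cos (i%:R * (2 * pi / n%:R) * k%:R) +i*
             sin (i%:R * (2 * pi / n%:R) * k%:R))); last first.
    by apply/eqP; rewrite eq_complex /=; apply/andP; split; apply/eqP; ring.
  rewrite mulrACA -[X in X * _]rmorphM -invfM -expr2 sqr_sqrtr ?ltW //.
  congr (_ * _); rewrite add0r [- (pi / 2) + _]addrC cosBpihalf.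
  rewrite (_ : k%:R * _ = j%:R * (2 * pi / n%:R) * k%:R - i%:R * (2 * pi / n%:R) * k%:R).
    rewrite cosB sinB; apply/eqP; rewrite eq_complex /=.
    by apply/andP; split; apply/eqP; ring.
  by rewrite rmorphB /=; field.
rewrite -mulr_sumr sum_complexE /=; have [<-|ij] := eqVneq i j.
  rewrite subrr; under eq_bigr do rewrite !mul0r !mulr0 addr0 cos0.
  under [X in _ +i* X]eq_bigr do rewrite !mul0r !mulr0 addr0 cosN cos_pihalf.
  rewrite [X in _ +i* X]big1 // sumr_const card_ord -rmorphM /= mulVf //.
have {}ij : (i : nat) != j by [].
by rewrite !sum_cos_period ?mulr0 //; have := ltn_ord i; have := ltn_ord j; lia.
Qed.

End Orthonormality.

(** * Iteration of a diagonalizable matrix *)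

Section Generalities.
Variable R : realType.

(** The arithmetic-geometric mean inequality for k x and k copies of 1 - x,
whose sum is k. *)
Lemma power_gap_bound (x : R) (k : nat) : (0 < k)%N -> 0 <= x <= 1 ->
  x * (1 - x) ^+ k <= k%:R ^+ k / k.+1%:R ^+ k.+1.
Proof.
move=> k0 /andP[x0 x1].
have kR : 0 < k%:R :> R by rewrite ltr0n.
pose E (i : 'I_k.+1) : R := if i == ord0 then k%:R * x else 1 - x.
have E0 : {in 'I_k.+1, forall i, 0 <= E i}.
  by move=> i _; rewrite /E; case: ifP => _; [exact: mulr_ge0 | rewrite subr_ge0].
have prodE : \prod_(i in 'I_k.+1) E i = k%:R * x * (1 - x) ^+ k.
  by rewrite big_ord_recl; congr (_ * _); rewrite prodr_const card_ord.
have sumE : \sum_(i in 'I_k.+1) E i = k%:R.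
  by rewrite big_ord_recl sumr_const card_ord /E /= -[_ *+ k]mulr_natr; ring.
have := leif_le (leif_AGM E0); rewrite prodE sumE card_ord expr_div_n => le_k.
by rewrite -(ler_pM2l kR) mulrA (le_trans le_k) // [in leLHS]exprS mulrA.
Qed.

(** The ratio is at most 1 / (k + 1). *)
Lemma exists_power_ratio_lt (eps : R) : 0 < eps ->
  exists2 k : nat, (0 < k)%N & k%:R ^+ k / k.+1%:R ^+ k.+1 < eps.
Proof.
move=> eps0; pose k := (Num.bound eps^-1).+1; exists k => //.
have k1 : 0 < k.+1%:R :> R by rewrite ltr0n.
apply: (@le_lt_trans _ _ k.+1%:R^-1).
  rewrite ler_pdivrMr ?exprn_gt0 // (exprS k.+1%:R) mulKf ?gt_eqF //.
  by rewrite lerXn2r ?nnegrE ?ler0n // ler_nat.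
rewrite invf_plt // (lt_trans (archi_boundP (ltW _))) ?invr_gt0 //.
by rewrite ltr_nat.
Qed.

Lemma cvg_mx_entrywise m n (u : nat -> 'M[R]_(m, n)) (M : 'M[R]_(m, n)) :
  (forall i j, (fun k => u k i j) @ \oo --> M i j) -> u @ \oo --> M.
Proof.
move=> uM; apply/cvg_ballP => e e0.
have : \forall k \near \oo, forall p : 'I_m * 'I_n, ball (M p.1 p.2) e (u k p.1 p.2).
  by apply: filter_forall => -[i j]; apply: (cvg_ballP _ _).1 e e0 => //; exact: uM.
by apply: filterS => k uk; split=> // i j; exact: (uk (i, j)).
Qed.

Lemma cvg_gap_power (x : R) : 0 <= x <= 1 ->
  (fun k : nat => (1 - x) ^+ k) @ \oo --> ((x == 0)%:R : R).
Proof.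
move=> /andP[x0 x1]; have [->|x_neq0] := eqVneq x 0.
  by rewrite subr0; under eq_fun do rewrite expr1n; exact: cvg_cst.
by apply: cvg_expr; rewrite ger0_norm; lra.
Qed.

Lemma cvg_sum_gap_power (I : finType) (a x : I -> R) :
  (forall i, 0 <= x i <= 1) ->
  (fun k : nat => \sum_i a i * (1 - x i) ^+ k) @ \oo --> \sum_i a i * (x i == 0)%:R.
Proof.
move=> x01; apply: cvg_big => [|i _]; first exact: add_continuous.
by apply: cvgMr; exact: cvg_gap_power.
Qed.

(** The intertwining relation lifts to the characteristic matrices, and the
determinant of Q cancels. *)
Lemma char_poly_intertwined (F : fieldType) n (A B Q : 'M[F]_n) :
  Q \in unitmx -> A *m Q = Q *m B -> char_poly A = char_poly B.
Proof.
move=> Qu AQ; pose q := map_mx (@polyC F) Q.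
have : char_poly_mx A *m q = q *m char_poly_mx B.
  by rewrite mulmxBl mulmxBr scalar_mxC -!map_mxM AQ.
move=> /(congr1 determinant); rewrite !det_mulmx mulrC.
apply: mulfI; rewrite det_map_mx polyC_eq0 -unitfE.
by rewrite -unitmxE.
Qed.

Lemma toC_mulmx m n p (A : 'M[R]_(m, n)) (B : 'M[R]_(n, p)) :
  toC (A *m B) = toC A *m toC B.
Proof. exact: map_mxM. Qed.

Lemma toC1 n : toC (1%:M : 'M[R]_n) = 1%:M.
Proof. exact: map_mx1. Qed.

Lemma toCB m n (A B : 'M[R]_(m, n)) : toC (A - B) = toC A - toC B.
Proof. exact: map_mxB. Qed.

Lemma diag_mx_exp n (d : 'rV[R[i]]_n) k :
  diag_mx d ^+ k = diag_mx (\row_j (d 0 j ^+ k)).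
Proof.
elim: k => [|k IH].
  by apply/matrixP => i j; rewrite !mxE expr0.
rewrite exprS IH -[_ * _]/(_ *m _) mulmx_diag.
by congr diag_mx; apply/rowP => j; rewrite !mxE exprS.
Qed.

(** The loop halts at the first step that meets the criterion. *)
Lemma dif_inner_loop_halts n (W : 'M[R]_n) delta s k :
  norm2 (dif_iter W s k.+1 - dif_iter W s k) < delta ->
  exists (m : nat) (f : 'cV[R]_n), (m <= k)%N /\ dif_inner_loop W delta s m f.
Proof.
elim: k s => [|k IH] s sk; first by exists 0%N, s; split => //; exact: dif_stop.
have [ns|ns] := ltP (norm2 (dif_step W s - s)) delta.
  by exists 0%N, s; split => //; exact: dif_stop.
have [|m [f [mk loop]]] := IH (dif_step W s); first by rewrite /dif_iter -!iterSr.
by exists m.+1, f; split => //; exact: dif_continue.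
Qed.
End Generalities.

Lemma normc_real (R : realType) (x : R) : ComplexField.Normc.normc x%:C = `|x|.
Proof. by rewrite /= expr0n addr0 sqrtr_sqr. Qed.

Lemma normc_ge0 (R : realType) (z : R[i]) : 0 <= ComplexField.Normc.normc z.
Proof. by case: z => a b; exact: sqrtr_ge0. Qed.

Lemma conjcM (R : realType) (z w : R[i]) : conjc (z * w) = conjc z * conjc w.
Proof.
case: z w => a b [c d]; apply/eqP; rewrite eq_complex /=.
by apply/andP; split; apply/eqP; ring.
Qed.

Lemma conjc_sum (R : realType) (I : finType) (F : I -> R[i]) :
  conjc (\sum_i F i) = \sum_i conjc (F i).
Proof.
elim/big_rec2: _ => [|i x y _ <-]; first exact: conjc0.
by case: (F i) y => a b [c d] /=; rewrite opprD.
Qed.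

Lemma Re_mulr_real (R : realType) (z : R[i]) (x : R) :
  complex.Re (z * x%:C) = complex.Re z * x.
Proof. by case: z => a b /=; ring. Qed.

Lemma Im_mulr_real (R : realType) (z : R[i]) (x : R) :
  complex.Im (z * x%:C) = complex.Im z * x.
Proof. by case: z => a b /=; ring. Qed.

Section Spectral.
Variables (R : realType) (n : nat).
Implicit Types (W : 'M[R]_n) (Q : 'M[R[i]]_n) (lam : 'I_n -> R) (B : {set 'I_n}).

(** The spectral information shared by the three boundary conditions. The set
B singles out the columns whose eigenvalue is 1 for every filter: the constant
column, or the two affine ones. Orthonormality is asked only off B, because
the affine columns are not orthogonal to the others. *)
Record dif_spectrum W Q lam B : Prop := DifSpectrum {
  spec_unit : Q \in unitmx;
  spec_eigen : toC W *m Q = Q *m diag_mx (\row_j (lam j)%:C);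
  spec_range : forall j, 0 <= lam j <= 1;
  spec_one : forall j, j \in B -> lam j = 1;
  spec_nontrivial : exists2 j, j \notin B & lam j != 0;
  spec_orthonormal : forall i j, i \notin B -> j \notin B ->
    \sum_k conjc (Q k i) * Q k j = (i == j)%:R }.

Variables (W : 'M[R]_n) (Q : 'M[R[i]]_n) (lam : 'I_n -> R) (B : {set 'I_n}).
Hypothesis spec : dif_spectrum W Q lam B.

Let Qu : Q \in unitmx. Proof. exact: spec_unit spec. Qed.
Let lam01 j : 0 <= lam j <= 1. Proof. exact: (spec_range spec). Qed.
Let D := invmx Q *m toC W *m Q.
Let Z := 1%:M - D.
Let zeta := num_zero_eigenvalues W.

Lemma spectral_D : D = diag_mx (\row_j (lam j)%:C).
Proof. by rewrite /D -mulmxA (spec_eigen spec) mulKmx. Qed.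

Lemma spectral_Z : Z = diag_mx (\row_j (1 - lam j)%:C).
Proof.
rewrite /Z spectral_D; apply/matrixP => i j; rewrite !mxE rmorphB /=.
by case: (i == j); rewrite ?mulr1n // !mulr0n subr0.
Qed.

Lemma spectral_Z_exp k : Z ^+ k = diag_mx (\row_j ((1 - lam j) ^+ k)%:C).
Proof.
rewrite spectral_Z diag_mx_exp; congr diag_mx.
by apply/rowP => j; rewrite !mxE rmorphXn.
Qed.

Lemma toC_W : toC W = Q *m D *m invmx Q.
Proof. by rewrite /D !mulmxA mulmxV // mul1mx mulmxK. Qed.

Lemma toC_dif_iter s k : toC (dif_iter W s k) = Q *m Z ^+ k *m invmx Q *m toC s.
Proof.
elim: k => [|k IH]; first by rewrite expr0 mulmx1 mulmxV // mul1mx.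
rewrite /dif_iter iterS -/(dif_iter W s k) /dif_step toC_mulmx IH toCB toC1.
have -> : 1%:M - toC W = Q *m Z *m invmx Q.
  by rewrite /Z mulmxBr mulmxBl mulmx1 mulmxV // -toC_W.
by rewrite exprS -[Z * _]/(Z *m _) !mulmxA mulmxKV.
Qed.

Lemma spectral_char_poly : char_poly W = \prod_j ('X - (lam j)%:P).
Proof.
apply: (map_poly_inj (real_complex R)); rewrite map_char_poly rmorph_prod /=.
rewrite (char_poly_intertwined Qu (spec_eigen spec)) char_poly_trig; last first.
  exact/is_diag_mx_is_trig/diag_mx_is_diag.
apply: eq_bigr => j _; rewrite !mxE eqxx mulr1n.
by rewrite rmorphB /= map_polyX map_polyC.
Qed.

Lemma spectral_zeta : zeta = #|[pred j | lam j == 0]|.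
Proof.
rewrite /zeta /num_zero_eigenvalues spectral_char_poly.
rewrite (bigID [pred j | lam j == 0]) /=.
rewrite (eq_bigr (fun=> 'X - 0%:P)) => [|j /eqP-> //].
rewrite prodr_const mupMl ?mup_XsubCX ?eqxx //.
rewrite rootE horner_prod; apply/prodf_neq0 => j lamj.
by rewrite hornerXsubC sub0r oppr_eq0.
Qed.

Lemma spectral_card :
  (#|B| + zeta + #|[pred j | (j \notin B) && (lam j != 0%R)]| = n)%N.
Proof.
have -> : (#|B| + zeta = #|[predU B & [pred j | lam j == 0%R]]|)%N.
  rewrite spectral_zeta -cardUI [X in (_ + X)%N]eq_card0 ?addn0 // => j.
  by rewrite !inE; apply/negP => /andP[/(spec_one spec)->]; rewrite oner_eq0.
rewrite -[RHS]card_ord -(cardC [predU B & [pred j | lam j == 0%R]]).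
by congr (_ + _)%N; apply: eq_card => j; rewrite !inE negb_or.
Qed.

Lemma spectral_card_lt : (#|B| + zeta < n)%N.
Proof.
rewrite -[X in (_ < X)%N]spectral_card -[X in (X < _)%N]addn0 ltn_add2l.
by have [j jB lamj] := spec_nontrivial spec; apply/card_gt0P; exists j; rewrite inE jB.
Qed.

(** The eigenvalues are listed with those of B first and the zero ones last; P
maps a column to its position in this list. *)
Lemma spectral_order : exists (P : 'S_n) (e : seq R),
  let d : 'rV[R[i]]_n :=
    \row_(i < n) (if (i < n - zeta)%N then (1 - e`_i)%:C else 1) in
  [/\ size e = (n - zeta)%N,
      0 \notin e,
      char_poly W = 'X^zeta * \prod_(x <- e) ('X - x%:P),
      Z = perm_mx P *m diag_mx d *m (perm_mx P)^T
    & forall i : 'I_n, (i < #|B|)%N -> d 0 i = 0].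
Proof.
pose ez := enum [pred j | lam j == 0].
pose enz := enum B ++ enum [pred j | (j \notin B) && (lam j != 0)].
have nz : size ez = zeta by rewrite -cardE -spectral_zeta.
have mem_enz j : (j \in enz) = (lam j != 0).
  rewrite mem_cat !mem_enum inE; case: (boolP (j \in B)) => //= /(spec_one spec) ->.
  by rewrite oner_neq0.
have mem_ez j : (j \in ez) = (lam j == 0) by rewrite mem_enum inE.
have uniq_e : uniq (enz ++ ez).
  rewrite cat_uniq enum_uniq andbT cat_uniq !enum_uniq /= andbT; apply/andP; split.
    by apply/hasPn => j; rewrite !mem_enum !inE => /andP[].
  by apply/hasPn => j; rewrite mem_ez mem_enz negbK.
have e_perm : perm_eq (enz ++ ez) (enum 'I_n).
  apply: uniq_perm; rewrite ?enum_uniq // => j.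
  by rewrite mem_cat mem_enz mem_ez mem_enum orNb.
have size_e : size (enz ++ ez) = n by rewrite (perm_size e_perm) size_enum_ord.
have size_enz : size enz = (n - zeta)%N by move: size_e; rewrite size_cat nz; lia.
have rank_lt j : (index j (enz ++ ez) < n)%N.
  have : (index j (enz ++ ez) < size (enz ++ ez))%N.
    by rewrite index_mem (perm_mem e_perm) mem_enum.
  by rewrite size_e.
have rank_inj : injective (fun j => Ordinal (rank_lt j)).
  move=> i j /(congr1 val) /= ij.
  by rewrite -(nth_index i (s := enz ++ ez) (x := i)) ?ij ?nth_index //
    (perm_mem e_perm) mem_enum.
exists (perm rank_inj), [seq lam j | j <- enz] => /=; split.
- by rewrite size_map.
- by apply/mapP => -[j]; rewrite mem_enz => /eqP h /esym.
- rewrite spectral_char_poly -[LHS]big_enum -(perm_big _ e_perm) big_cat mulrC /=.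
  rewrite big_map; congr (_ * _).
  rewrite big_seq (eq_bigr (fun=> 'X)).
    by rewrite -big_seq big_const_seq count_predT nz iter_mulr_1.
  by move=> j; rewrite mem_ez => /eqP->; rewrite subr0.
- rewrite spectral_Z tr_perm_mx -row_permE -col_permE.
  apply/matrixP => i j; rewrite !mxE (inj_eq perm_inj); case: eqVneq => // _.
  rewrite !mulr1n permE /= index_cat -size_enz.
  case: (boolP (i \in enz)) => [iz|]; last first.
    by rewrite mem_enz negbK => /eqP ->; rewrite ltnNge leq_addr subr0.
  rewrite index_mem iz (nth_map i) ?index_mem // nth_index //.
- move=> i iB; rewrite mxE; have -> : (i < n - zeta)%N.
    by rewrite -size_enz size_cat -cardE ltn_addr.
  rewrite (nth_map i); last by rewrite size_cat -cardE ltn_addr.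
  rewrite nth_cat -cardE iB (spec_one spec) ?subrr //.
  by rewrite -mem_enum mem_nth // -cardE.
Qed.

(** The limit of the iterates is real although Q may be complex, since the
coordinates of all iterates in the eigenbasis combine to real vectors. *)
Lemma spectral_limit (s : 'cV[R]_n) : exists Zoo : 'M[R[i]]_n,
  [/\ is_diag_mx Zoo,
      forall i : 'I_n, Zoo i i = 0 \/ Zoo i i = 1,
      #|[pred i : 'I_n | Zoo i i == 1]| = zeta,
      forall i j : 'I_n,
        (fun k : nat => ComplexField.Normc.normc ((Z ^+ k) i j - Zoo i j))
          @ \oo --> (0 : R)
    & exists f1 : 'cV[R]_n,
        toC f1 = Q *m Zoo *m invmx Q *m toC s /\
        (fun k : nat => dif_iter W s k) @ \oo --> f1].
Proof.
pose Zoo : 'M[R[i]]_n := diag_mx (\row_j (lam j == 0)%:R).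
exists Zoo; split.
- exact: diag_mx_is_diag.
- by move=> i; rewrite !mxE eqxx mulr1n; case: (lam i == 0); [right | left].
- rewrite spectral_zeta; apply: eq_card => i; rewrite !inE !mxE eqxx mulr1n.
  by case: (lam i == 0); rewrite ?eqxx // eq_sym oner_eq0.
- move=> i j; rewrite /Zoo; under eq_fun do rewrite spectral_Z_exp !mxE.
  case: (i == j); last first.
    by under eq_fun do rewrite !mulr0n subr0 ComplexField.Normc.normc0; exact: cvg_cst.
  under eq_fun do rewrite !mulr1n.
  under eq_fun do rewrite -(rmorph_nat (real_complex R)) -rmorphB normc_real.
  have h : (fun k : nat => (1 - lam i) ^+ k - (lam i == 0)%:R) @ \oo --> (0 : R).
    pose b : R := (lam i == 0)%:R.
    suff : (fun k : nat => (1 - lam i) ^+ k - b) @ \oo --> b - b.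
      by rewrite subrr.
    by apply: cvgB; [exact: cvg_gap_power | exact: cvg_cst].
  have := cvg_norm h; rewrite normr0; exact.
pose c := invmx Q *m toC s.
pose f (p : R[i] -> R) : 'cV[R]_n := \col_i \sum_j p (Q i j * c j 0) * (lam j == 0)%:R.
have expand (i : 'I_n) (x : 'I_n -> R) :
    (Q *m diag_mx (\row_j (x j)%:C) *m c) i 0 =
    (\sum_j complex.Re (Q i j * c j 0) * x j) +i*
    (\sum_j complex.Im (Q i j * c j 0) * x j).
  rewrite mxE sum_complexE; congr (_ +i* _); apply: eq_bigr => j _;
    by rewrite mul_mx_diag mxE mxE mulrAC ?Re_mulr_real ?Im_mulr_real.
have iterE k i : (dif_iter W s k i 0)%:C =
    (Q *m diag_mx (\row_j ((1 - lam j) ^+ k)%:C) *m c) i 0.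
  by rewrite -spectral_Z_exp /c mulmxA -toC_dif_iter mxE.
have reE k i : dif_iter W s k i 0 =
    \sum_j complex.Re (Q i j * c j 0) * (1 - lam j) ^+ k.
  by have := iterE k i; rewrite expand => -[].
have imE k i : \sum_j complex.Im (Q i j * c j 0) * (1 - lam j) ^+ k = 0.
  by have := iterE k i; rewrite expand => -[].
exists (f (@complex.Re R)); split.
  have -> : Zoo = diag_mx (\row_j ((lam j == 0)%:R : R)%:C).
    by congr diag_mx; apply/rowP => j; rewrite !mxE rmorph_nat.
  apply/colP => i; rewrite -mulmxA expand !mxE; congr (_ +i* _).
  (* a limit of imaginary parts of real vectors *)
  have := cvg_sum_gap_power (a := fun j => complex.Im (Q i j * c j 0)) lam01.
  under eq_fun do rewrite imE.
  by apply: cvg_unique => //; exact: cvg_cst.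
apply: cvg_mx_entrywise => i j; rewrite (ord1 j) mxE.
by under eq_fun do rewrite reE; exact: cvg_sum_gap_power.
Qed.

(** Parseval's identity for vectors without component along B. *)
Lemma spectral_parseval (x : 'cV[R[i]]_n) (y : 'cV[R]_n) :
  (forall j, j \in B -> x j 0 = 0) -> toC y = Q *m x ->
  \sum_i y i 0 ^+ 2 = \sum_j ComplexField.Normc.normc (x j 0) ^+ 2.
Proof.
move=> xB yE; apply: (@complexI R); rewrite !rmorph_sum /=.
have sq z : (ComplexField.Normc.normc z ^+ 2)%:C = conjc z * z.
  by rewrite rmorphXn; have := sqr_normc z; rewrite mulrC => <-; case: z.
under [RHS]eq_bigr do rewrite sq.
have yi i : (y i 0 ^+ 2)%:C =
    \sum_a \sum_b conjc (x a 0) * x b 0 * (conjc (Q i a) * Q i b).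
  have := congr1 (fun A : 'cV[R[i]]_n => A i 0) yE; rewrite !mxE => yiE.
  have -> : (y i 0 ^+ 2)%:C = conjc (y i 0)%:C * (y i 0)%:C.
    by rewrite conjc_real expr2 rmorphM.
  rewrite yiE conjc_sum mulr_suml.
  apply: eq_bigr => a _; rewrite mulr_sumr; apply: eq_bigr => b _.
  by rewrite conjcM; ring.
under eq_bigr do rewrite yi.
rewrite exchange_big; apply: eq_bigr => a _; rewrite exchange_big /=.
under eq_bigr do rewrite -mulr_sumr.
have [aB|aB] := boolP (a \in B).
  by rewrite xB // conjc0 mul0r big1 // => b _; rewrite !mul0r.
rewrite (bigD1 a) //= (spec_orthonormal spec) // eqxx mulr1 big1 ?addr0 // => b ba.
have [bB|bB] := boolP (b \in B); first by rewrite (xB b) // mulr0 mul0r.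
by rewrite (spec_orthonormal spec) // eq_sym (negbTE ba) mulr0.
Qed.

(** The step multiplies the j-th coordinate by - lam_j (1 - lam_j)^k. For k > 0
this vanishes on B, and where lam_j = 0, so at most n - #|B| - zeta coordinates
remain; the bound is taken at k0 as (1 - lam_j)^k decreases with k. *)
Lemma spectral_step_bound (s : 'cV[R]_n) (k k0 : nat) : (0 < k0 <= k)%N ->
  norm2 (dif_iter W s k.+1 - dif_iter W s k) <=
  k0%:R ^+ k0 / k0.+1%:R ^+ k0.+1
    * (norm_inf (invmx Q *m toC s) * Num.sqrt (n%:R - #|B|%:R - zeta%:R)).
Proof.
move=> /andP[k0_gt0 k0k]; set c := invmx Q *m toC s.
set g : R := _ / _; set M := norm_inf c.
have g0 : 0 <= g by rewrite divr_ge0 ?exprn_ge0.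
have cM j : ComplexField.Normc.normc (c j 0) <= M.
  exact: (le_bigmax _ (fun j => ComplexField.Normc.normc (c j 0))).
have M0 : 0 <= M by exact: bigmax_ge_id.
pose x := (Z ^+ k.+1 - Z ^+ k) *m c.
have normc_x j : ComplexField.Normc.normc (x j 0) =
    lam j * (1 - lam j) ^+ k * ComplexField.Normc.normc (c j 0).
  rewrite /x !spectral_Z_exp -linearB /= mul_diag_mx mxE ComplexField.Normc.normcM !mxE.
  rewrite -rmorphB normc_real; congr (_ * _).
  have /andP[l0 l1] := lam01 j.
  rewrite exprS -{2}[_ ^+ k]mul1r -mulrBl addrAC subrr sub0r mulNr normrN.
  by rewrite ger0_norm // mulr_ge0 // exprn_ge0 // subr_ge0.
have xB j : j \in B -> x j 0 = 0.
  move=> jB; apply: ComplexField.Normc.eq0_normc; rewrite normc_x (spec_one spec) //.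
  by rewrite subrr expr0n gtn_eqF ?mulr0 ?mul0r //; lia.
have yE : toC (dif_iter W s k.+1 - dif_iter W s k) = Q *m x.
  by rewrite toCB !toC_dif_iter /x /c mulmxBl mulmxBr !mulmxA.
rewrite /norm2 (spectral_parseval xB yE).
have cardE : n%:R - #|B|%:R - zeta%:R =
    #|[pred j | (j \notin B) && (lam j != 0)]|%:R :> R.
  by have := congr1 (fun m => m%:R : R) spectral_card; rewrite !natrD; lra.
rewrite cardE mulrA -[g * M]ger0_norm ?mulr_ge0 // -sqrtr_sqr -sqrtrM ?sqr_ge0 //.
apply: ler_wsqrtr; rewrite mulr_natr -sumr_const.
rewrite [leLHS](bigID [pred j | (j \notin B) && (lam j != 0)]) /= [X in _ + X]big1 ?addr0.
  apply: ler_sum => j _; rewrite ler_sqr ?nnegrE ?mulr_ge0 ?normc_ge0 //.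
  have /andP[l0 l1] := lam01 j.
  rewrite normc_x ler_pM ?normc_ge0 ?mulr_ge0 ?exprn_ge0 ?subr_ge0 //.
  apply: le_trans (power_gap_bound k0_gt0 (lam01 j)).
  by rewrite ler_wpM2l // ler_wiXn2l // ?subr_ge0 // gerBl.
move=> j; rewrite negb_and !negbK => /orP[jB|/eqP lamj].
  by rewrite xB // ComplexField.Normc.normc0 expr0n.
by rewrite normc_x lamj !mul0r expr0n.
Qed.

(** With [spectral_card_lt], this keeps the denominator of the stopping bound
away from 0, where the quotient would be 0 and no k0 would exist. *)
Lemma norm_inf_coordinates_gt0 (s : 'cV[R]_n) : s != 0 ->
  0 < norm_inf (invmx Q *m toC s).
Proof.
apply: contraNT; rewrite -leNgt => /bigmax_leP[_ c0].
have : invmx Q *m toC s = 0.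
  apply/colP => j; rewrite [RHS]mxE; apply: ComplexField.Normc.eq0_normc.
  by apply/eqP; rewrite eq_le c0 ?normc_ge0.
move=> /(congr1 (mulmx Q)); rewrite mulmxA mulmxV // mul1mx mulmx0 => s0.
apply/eqP/colP => j; apply: (@complexI R).
by have := congr1 (fun A : 'cV[R[i]]_n => A j 0) s0; rewrite !mxE.
Qed.

Lemma spectral_stopping (s : 'cV[R]_n) (alpha delta : R) :
  s != 0 -> 1 <= alpha -> 0 < delta ->
  let bound (k : nat) : Prop :=
    k%:R ^+ k / k.+1%:R ^+ k.+1
    < delta / (alpha * norm_inf (invmx Q *m toC s)
               * Num.sqrt (n%:R - #|B|%:R - zeta%:R)) in
  exists k0 : nat,
    [/\ (0 < k0)%N,
        bound k0,
        forall k : nat, (0 < k)%N -> bound k -> (k0 <= k)%N,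
        forall k : nat, (k0 <= k)%N ->
          norm2 (dif_iter W s k.+1 - dif_iter W s k) < delta
      & exists (m : nat) (f1 : 'cV[R]_n),
          (m <= k0)%N /\ dif_inner_loop W delta s m f1].
Proof.
move=> s0 alpha1 delta0 bound.
have M0 := norm_inf_coordinates_gt0 s0.
pose M := norm_inf (invmx Q *m toC s); pose r : R := Num.sqrt (n%:R - #|B|%:R - zeta%:R).
rewrite -/M in M0.
have r0 : 0 < r.
  by rewrite /r sqrtr_gt0 -addrA -opprD -natrD subr_gt0 ltr_nat spectral_card_lt.
have alpha0 : 0 < alpha by exact: lt_le_trans alpha1.
have K0 : 0 < alpha * M * r by rewrite !mulr_gt0.
have ex : exists k, (0 < k)%N && (k%:R ^+ k / k.+1%:R ^+ k.+1 < delta / (alpha * M * r)).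
  have [k k_gt0 kP] := exists_power_ratio_lt (divr_gt0 delta0 K0).
  by exists k; rewrite k_gt0.
case: (ex_minnP ex) => k0 /andP[k0_gt0 k0_bound] k0_min.
have stop k : (k0 <= k)%N -> norm2 (dif_iter W s k.+1 - dif_iter W s k) < delta.
  move=> k0k; apply: le_lt_trans (spectral_step_bound s (k0 := k0) _) _.
    by rewrite k0_gt0.
  rewrite -/M -/r; move: k0_bound; rewrite ltr_pdivlMr //; apply: le_lt_trans.
  rewrite ler_wpM2l ?divr_ge0 ?exprn_ge0 //.
  by rewrite -mulrA ler_peMl // mulr_ge0 ?ltW.
exists k0; split => //.
  by move=> k k_gt0 k_bound; apply: k0_min; rewrite k_gt0.
by apply: dif_inner_loop_halts; exact: stop.
Qed.

End Spectral.

(** * The three boundary conditions *)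

Section Instances.
Variable R : realType.

Lemma mulmx_diag_cols (F : fieldType) n (A Q : 'M[F]_n) (d : 'rV_n) :
  (forall j, A *m col j Q = d 0 j *: col j Q) -> A *m Q = Q *m diag_mx d.
Proof.
move=> AQ; apply/matrixP => i j; rewrite mul_mx_diag [RHS]mxE mulrC.
have := congr1 (fun M : 'cV_n => M i 0) (AQ j).
by rewrite [RHS]mxE [in RHS]mxE => <-; rewrite !mxE; apply: eq_bigr => k _; rewrite mxE.
Qed.

Lemma real_eigen n (W Q : 'M[R]_n) (lam : 'I_n -> R) :
  (forall j, W *m col j Q = lam j *: col j Q) ->
  toC W *m toC Q = toC Q *m diag_mx (\row_j (lam j)%:C).
Proof.
move=> WQ; rewrite -toC_mulmx (mulmx_diag_cols (d := \row_j lam j)).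
  rewrite toC_mulmx; congr (_ *m _); rewrite /toC map_diag_mx; congr diag_mx.
  by apply/rowP => j; rewrite !mxE.
by move=> j; rewrite mxE.
Qed.

Lemma real_orthonormal n (Q : 'M[R]_n) (i j : 'I_n) :
  \sum_k conjc (toC Q k i) * toC Q k j = (\sum_k Q k i * Q k j)%:C.
Proof.
rewrite rmorph_sum; apply: eq_bigr => k _.
by rewrite !mxE conjc_real rmorphM.
Qed.

Lemma mulmx_eigenZ (F : fieldType) n (A : 'M[F]_n) (x : 'cV_n) (a c : F) :
  A *m x = a *: x -> A *m (c *: x) = a *: (c *: x).
Proof. by move=> Ax; rewrite -scalemxAr Ax !scalerA mulrC. Qed.

Section Instance.
Variables (n l : nat) (v : int -> R).
Hypothesis hl : (0 < l <= n.-1 %/ 4)%N.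
Hypothesis hv : sym_dec_filter n l v.
Let w := filter_conv l v v.

Let v_sym : filter_symmetric v. Proof. by case: hv. Qed.
Let v_out (j : int) : (l < `|j|)%N -> v j = 0.
Proof. by case: hv => -[_ _ + _] _ _; exact. Qed.
Let w_sym : filter_symmetric w. Proof. exact: filter_conv_symmetric hv. Qed.
Let n_neq0 : n%:R != 0 :> R. Proof. by rewrite pnatr_eq0; lia. Qed.

Let lamv theta := symbol l v theta ^+ 2.

Lemma symbol_w theta : symbol (2 * l) w theta = lamv theta.
Proof. exact: symbol_conv. Qed.

Let lamv01 theta : 0 <= lamv theta <= 1.
Proof.
rewrite /lamv sqr_ge0 /= -real_normK ?num_real // expr_le1 //.
exact: norm_symbol_le1 hv _.
Qed.

Let lamv0 : lamv 0 = 1.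
Proof.
by rewrite /lamv symbol0; case: hv => -[_ _ _ /= v1] _ _; rewrite /wsum v1 expr1n.
Qed.

Let lamv_neq0 theta : 0 <= theta -> theta * l%:R < pi / 2 -> lamv theta != 0.
Proof. by move=> t0 tl; rewrite expf_neq0 // gt_eqF // (symbol_gt0 hv). Qed.

Lemma reflective_column (j : 'I_n) :
  bc_matrix Reflective n (2 * l) w *m col j (QR R n)
  = lamv (j%:R * pi / n%:R) *: col j (QR R n).
Proof.
set theta := _ / _.
have -> : col j (QR R n) = Num.sqrt ((2 - (j == 0%N :> nat)%:R) / n%:R) *:
    sampling n (fun i => cos (theta * i%:~R + theta / 2)).
  apply/colP => i; rewrite !mxE; congr (_ * cos _); rewrite /theta.
  by field.
apply: mulmx_eigenZ; rewrite -symbol_w; apply: bc_matrix_cos => //.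
apply: bc_extend_reflective => [|i|i]; first lia.
  by rewrite -cosN; congr cos; rewrite rmorphB /=; field.
rewrite -cosN -(cosD2intpi _ j); congr cos; rewrite !rmorphB /= /theta.
by rewrite -[(2 * n)%N%:~R]/((2 * n)%:R) natrM; field.
Qed.

(** The real and imaginary parts of the column are sampled cosines of the same
angle, the second with phase - pi / 2. *)
Lemma periodic_column (j : 'I_n) :
  toC (bc_matrix Periodic n (2 * l) w) *m col j (QP R n)
  = (lamv (j%:R * (2 * pi / n%:R)))%:C *: col j (QP R n).
Proof.
set theta := _ * _.
pose f phi := sampling n (fun i => cos (theta * i%:~R + phi)).
have -> : col j (QP R n) = ((Num.sqrt n%:R)^-1)%:C *:
    (toC (f 0) + 'i%C *: toC (f (- (pi / 2)))).
  apply/colP => i; rewrite mxE QP_entry /= !mxE addr0 cosBpihalf; congr (_ * _).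
  by rewrite [LHS]complexE.
have fE phi : toC (bc_matrix Periodic n (2 * l) w) *m toC (f phi) =
    (lamv theta)%:C *: toC (f phi).
  rewrite -toC_mulmx bc_matrix_cos // ?symbol_w ?/toC ?map_mxZ //.
  apply: bc_extend_periodic => [|i]; first lia.
  rewrite -[RHS](cosD2intpi _ j); congr cos; rewrite rmorphD /= /theta.
  by field.
by apply: mulmx_eigenZ; rewrite mulmxDr fE scalerDr (mulmx_eigenZ _ (fE _)).
Qed.

(** The sine is odd about both ends, where it vanishes. *)
Lemma antireflective_interior_column (j : 'I_n) : (0 < j < n.-1)%N ->
  bc_matrix AntiReflective n (2 * l) w *m col j (QAR R n)
  = lamv (j%:R * pi / n.-1%:R) *: col j (QAR R n).
Proof.
move=> jI; set theta := _ / _.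
have N0 : n.-1%:R != 0 :> R by rewrite pnatr_eq0; lia.
pose f (i : int) : R := cos (theta * i%:~R + - (pi / 2)).
have fE i : f i = sin (theta * i%:~R) by rewrite /f cosBpihalf.
have -> : col j (QAR R n) = Num.sqrt (2 / n.-1%:R) *: sampling n f.
  apply/colP => i; rewrite mxE QAR_interior // !mxE fE; congr (_ * sin _).
  by rewrite /theta; field.
apply: mulmx_eigenZ; rewrite -symbol_w; apply: bc_matrix_cos => //.
apply: (@bc_extend_antireflective _ _ _ f) => [|i|i]; first lia.
  by rewrite !fE mulr0 sin0 mulr0 sub0r mulrNz mulrN sinN.
rewrite !fE (_ : theta * n.-1%:~R = j%:~R * pi); last by rewrite /theta; field.
rewrite sin_intpi mulr0 sub0r -sinN -[RHS](sinD2intpi _ j); congr sin.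
rewrite rmorphB /= /theta -[(2 * n.-1)%N%:~R]/((2 * n.-1)%:R) natrM.
by field.
Qed.

Lemma antireflective_affine_column (a b : R) :
  let c := \col_(i < n) (a * i%:R + b) in
  bc_matrix AntiReflective n (2 * l) w *m c = c.
Proof.
pose f (i : int) : R := a * i%:~R + b.
have -> : \col_(i < n) (a * i%:R + b) = sampling n f by apply/colP => i; rewrite !mxE.
rewrite /= bc_matrix_affine //; first exact: filter_conv_sum hv.
apply: (@bc_extend_antireflective _ _ _ f) => [|i|i]; first lia.
  by rewrite /f mulrNz; ring.
rewrite /f rmorphB /= -[(2 * n.-1)%N%:~R]/((2 * n.-1)%:R) natrM; ring.
Qed.

(** In each of the next three lemmas the column j = 1 provides the nonzero
eigenvalue outside B, as l <= (n - 1) / 4 keeps its angle times l below pi / 2. *)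
Lemma periodic_spectrum : exists lam (B : {set 'I_n}),
  #|B| = 1%N /\ dif_spectrum (bc_matrix Periodic n (2 * l) w) (QP R n) lam B.
Proof.
have n1 : (1 < n)%N by lia.
pose j0 : 'I_n := Ordinal (ltnW n1); pose j1 : 'I_n := Ordinal n1.
exists (fun j : 'I_n => lamv (j%:R * (2 * pi / n%:R))), [set j0]%SET.
split; first exact: cards1.
split => [|||j /set1P->||i j _ _].
- apply: (@mulmx1_unit _ _ (\matrix_(i, j) conjc (QP R n j i)) _ _).2.
  apply/matrixP => i j; rewrite mxE [RHS]mxE -QP_orthonormal.
  by apply: eq_bigr => k _; rewrite mxE.
- by apply: mulmx_diag_cols => j; rewrite mxE; exact: periodic_column.
- by [].
- by rewrite mul0r.
- exists j1; first by apply/set1P.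
  rewrite mul1r; apply: lamv_neq0; first by rewrite divr_ge0 ?mulr_ge0 ?pi_ge0.
  rewrite mulrAC ltr_pdivrMr ?ltr0n; last lia.
  rewrite (_ : 2 * pi * l%:R = pi / 2 * (4 * l)%:R); last by rewrite natrM; field.
  by rewrite ltr_pM2l ?divr_gt0 ?pi_gt0 // ltr_nat; lia.
- exact: QP_orthonormal.
Qed.

Lemma reflective_spectrum : exists lam (B : {set 'I_n}),
  #|B| = 1%N /\
  dif_spectrum (bc_matrix Reflective n (2 * l) w) (toC (QR R n)) lam B.
Proof.
have n1 : (1 < n)%N by lia.
pose j0 : 'I_n := Ordinal (ltnW n1); pose j1 : 'I_n := Ordinal n1.
exists (fun j : 'I_n => lamv (j%:R * pi / n%:R)), [set j0]%SET.
split; first exact: cards1.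
split => [|||j /set1P->||i j _ _].
- rewrite map_unitmx; apply: (@mulmx1_unit _ _ (QR R n)^T _ _).2.
  apply/matrixP => i j; rewrite mxE [RHS]mxE -QR_orthonormal.
  by apply: eq_bigr => k _; rewrite mxE.
- by apply: real_eigen => j; exact: reflective_column.
- by [].
- by rewrite !mul0r.
- exists j1; first by apply/set1P.
  rewrite mul1r; apply: lamv_neq0; first by rewrite divr_ge0 ?pi_ge0.
  rewrite mulrAC ltr_pdivrMr ?ltr0n; last lia.
  rewrite (_ : pi * l%:R = pi / 2 * (2 * l)%:R); last by rewrite natrM; field.
  by rewrite ltr_pM2l ?divr_gt0 ?pi_gt0 // ltr_nat; lia.
- by rewrite real_orthonormal QR_orthonormal rmorph_nat.
Qed.

Let eta : R := Num.sqrt (\sum_(j < n) j%:R ^+ 2).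

Let eta_neq0 : eta != 0.
Proof.
have n1 : (1 < n)%N by lia.
rewrite gt_eqF // sqrtr_gt0 (bigD1 (Ordinal n1)) //= ltr_wpDr ?expr1n //.
by apply: sumr_ge0 => j _; rewrite sqr_ge0.
Qed.

Lemma QAR_left (j : 'I_n) : j = 0%N :> nat ->
  col j (QAR R n) = \col_i (- eta^-1 * i%:R + n.-1%:R / eta).
Proof. by move=> j0; apply/colP => i; rewrite !mxE j0 /= -/eta; ring. Qed.

Lemma QAR_right (j : 'I_n) : j = n.-1 :> nat ->
  col j (QAR R n) = \col_i (eta^-1 * i%:R + 0).
Proof.
move=> jn; apply/colP => i; rewrite !mxE jn eqxx gtn_eqF; last lia.
by rewrite -/eta addr0 mulrC.
Qed.

(** In the kernel, the first and last rows annihilate the two affine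
coordinates; the interior columns, being orthonormal, annihilate the rest. *)
Lemma QAR_unit : QAR R n \in unitmx.
Proof.
rewrite -unitmx_tr -row_free_unit; apply/inj_row_free => x xQ.
have {}xQ i : \sum_j QAR R n i j * x 0 j = 0.
  have := congr1 (fun A : 'rV_n => A 0 i) xQ; rewrite mxE [RHS]mxE => xQi.
  rewrite -[RHS]xQi.
  by apply: eq_bigr => j _; rewrite [RHS]mulrC [in RHS]mxE.
have N0 : n.-1%:R != 0 :> R by rewrite pnatr_eq0; lia.
have x0 (j : 'I_n) : j = 0%N :> nat -> x 0 j = 0.
  move=> j0; have := xQ j; rewrite (bigD1 j) //= [X in _ + X]big1 => [|k kj].
    rewrite addr0 mxE j0 /= subr0 => /eqP.
    by rewrite mulf_eq0 mulf_eq0 invr_eq0 (negbTE eta_neq0) (negbTE N0) => /eqP.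
  have {}kj : (k : nat) != 0%N by rewrite -j0.
  by rewrite mxE (negbTE kj) j0 eqxx; case: ifP; rewrite !mul0r.
have xn (j : 'I_n) : j = n.-1 :> nat -> x 0 j = 0.
  move=> jn; have := xQ j; rewrite (bigD1 j) //= [X in _ + X]big1 => [|k kj].
    rewrite addr0 mxE jn eqxx gtn_eqF; last lia.
    move=> /eqP; rewrite mulf_eq0 mulf_eq0 invr_eq0.
    by rewrite (negbTE eta_neq0) (negbTE N0) => /eqP.
  have {}kj : (k : nat) != n.-1 by rewrite -jn.
  rewrite mxE jn eqxx orbT (negbTE kj) subrr.
  by case: ifP; rewrite !mul0r.
have x_edge (j : 'I_n) : ~~ (0 < j < n.-1)%N -> x 0 j = 0.
  move=> jI; have [/x0//|jn] : (j : nat) = 0%N \/ (j : nat) = n.-1.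
    by have := ltn_ord j; lia.
  exact: xn.
apply/rowP => j; rewrite [RHS]mxE.
have [jI|/x_edge//] := boolP (0 < j < n.-1)%N.
transitivity (\sum_k QAR R n k j * \sum_b QAR R n k b * x 0 b); last first.
  by rewrite big1 // => k _; rewrite xQ mulr0.
under eq_bigr do rewrite mulr_sumr; rewrite exchange_big (bigD1 j) //=.
under eq_bigr do rewrite mulrA; rewrite -mulr_suml QAR_orthonormal // eqxx mul1r.
rewrite big1 ?addr0 // => b bj; under eq_bigr do rewrite mulrA.
rewrite -mulr_suml; have [bI|/x_edge->] := boolP (0 < b < n.-1)%N; last by rewrite mulr0.
by rewrite QAR_orthonormal // eq_sym (negbTE bj) mul0r.
Qed.

Lemma antireflective_spectrum : exists lam (B : {set 'I_n}),
  #|B| = 2%N /\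
  dif_spectrum (bc_matrix AntiReflective n (2 * l) w) (toC (QAR R n)) lam B.
Proof.
have n0 : (0 < n)%N by lia.
have n1 : (1 < n)%N by lia.
have nn : (n.-1 < n)%N by lia.
pose j0 : 'I_n := Ordinal n0; pose jn : 'I_n := Ordinal nn.
have edge (j : 'I_n) : (j \in [set j0; jn]%SET) = ~~ (0 < j < n.-1)%N.
  rewrite finset.in_set2 -!val_eqE /=; have := ltn_ord j; lia.
exists (fun j : 'I_n => if (0 < j < n.-1)%N then lamv (j%:R * pi / n.-1%:R) else 1).
exists [set j0; jn]%SET; split; first by rewrite cards2 -val_eqE /= ltn_eqF //; lia.
split => [||j|j||i j].
- by rewrite map_unitmx QAR_unit.
- apply: real_eigen => j; case: ifPn => jI; first exact: antireflective_interior_column.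
  rewrite scale1r; have [jE|jE] : (j : nat) = 0%N \/ (j : nat) = n.-1.
    by have := ltn_ord j; lia.
    by rewrite QAR_left // antireflective_affine_column.
  by rewrite QAR_right // antireflective_affine_column.
- by case: ifP => _; rewrite ?lamv01 // ler01 lexx.
- by rewrite edge => /negbTE ->.
- exists (Ordinal n1); first by rewrite edge negbK /=; lia.
  rewrite ifT /=; last lia.
  have N0 : 0 < n.-1%:R :> R by rewrite ltr0n; lia.
  rewrite mul1r; apply: lamv_neq0; first by rewrite divr_ge0 ?pi_ge0.
  rewrite mulrAC ltr_pdivrMr //.
  rewrite (_ : pi * l%:R = pi / 2 * (2 * l)%:R); last by rewrite natrM; field.
  by rewrite ltr_pM2l ?divr_gt0 ?pi_gt0 // ltr_nat; lia.
- rewrite !edge !negbK => iI jI.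
  by rewrite real_orthonormal QAR_orthonormal // rmorph_nat.
Qed.

Lemma bc_spectrum bc : exists lam (B : {set 'I_n}),
  #|B| = bc_beta bc /\
  dif_spectrum (bc_matrix bc n (2 * l) w) (bc_Q R bc n) lam B.
Proof.
case: bc; [exact: periodic_spectrum | exact: reflective_spectrum |].
exact: antireflective_spectrum.
Qed.

End Instance.
End Instances.

Theorem theorem2 (R : realType) (n : nat) (s : 'cV[R]_n) (hs : norm2 s = 1)
    (l' : nat) (hl' : (0 < l' <= n.-1 %/ 4)%N)
    (v : int -> R) (hv : sym_dec_filter n l' v)
    (bc : boundary_condition) :
  let l := (2 * l')%N in
  let w := filter_conv l' v v in
  let W := bc_matrix bc n l w in
  let Q := bc_Q R bc n in
  let D := invmx Q *m toC W *m Q in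
  let Z := 1%:M - D in
  let zeta := num_zero_eigenvalues W in
  let alpha := bc_alpha R bc in
  let beta := bc_beta bc in
  (* the setting *)
  [/\ sym_dec_filter n l w,
      Q \in unitmx,
      is_diag_mx D,
      toC W = Q *m D *m invmx Q
    & (zeta < n)%N] /\
  (* (1) *)
  ((forall k : nat,
      toC (dif_iter W s k) = Q *m (Z ^+ k) *m invmx Q *m toC s) /\
   exists (P : 'S_n) (lam : seq R),
     let d : 'rV[R[i]]_n :=
       \row_(i < n) (if (i < n - zeta)%N then (1 - lam`_i)%:C else 1) in
     [/\ size lam = (n - zeta)%N,
         0 \notin lam,
         char_poly W = 'X^zeta * \prod_(x <- lam) ('X - x%:P),
         Z = perm_mx P *m diag_mx d *m (perm_mx P)^T
       & forall i : 'I_n, (i < beta)%N -> d 0 i = 0]) /\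
  (* (2) *)
  (exists Zoo : 'M[R[i]]_n,
     [/\ is_diag_mx Zoo,
         forall i : 'I_n, Zoo i i = 0 \/ Zoo i i = 1,
         #|[pred i : 'I_n | Zoo i i == 1]| = zeta,
         forall i j : 'I_n,
           (fun k : nat => ComplexField.Normc.normc ((Z ^+ k) i j - Zoo i j))
             @ \oo --> (0 : R)
       & exists f1 : 'cV[R]_n,
           toC f1 = Q *m Zoo *m invmx Q *m toC s /\
           (fun k : nat => dif_iter W s k) @ \oo --> f1]) /\
  (* (3) *)
  (forall delta : R, 0 < delta ->
     let bound (k : nat) : Prop :=
       k%:R ^+ k / k.+1%:R ^+ k.+1
       < delta / (alpha * norm_inf (invmx Q *m toC s)
                  * Num.sqrt (n%:R - beta%:R - zeta%:R)) in
     exists k0 : nat,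
       [/\ (0 < k0)%N,
           bound k0,
           forall k : nat, (0 < k)%N -> bound k -> (k0 <= k)%N,
           forall k : nat, (k0 <= k)%N ->
             norm2 (dif_iter W s k.+1 - dif_iter W s k) < delta
         & exists (m : nat) (f1 : 'cV[R]_n),
             (m <= k0)%N /\ dif_inner_loop W delta s m f1]).
Proof.
move=> l w W Q D Z zeta alpha beta.
have [lam [B [cardB spec]]] := bc_spectrum hl' hv bc.
rewrite -/l -/w -/W -/Q in spec.
have s0 : s != 0.
  apply: contra_eq_neq hs => ->; rewrite /norm2 big1 ?sqrtr0 1?eq_sym ?oner_eq0 //.
  by move=> i _; rewrite mxE expr0n.
have alpha1 : 1 <= alpha by rewrite /alpha; case: (bc) => //=; rewrite ler1n.
split; [split | split; [split | split]].
- by apply: filter_conv_sym_dec hv _ _; lia.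
- exact: spec_unit spec.
- by rewrite /D (spectral_D spec) diag_mx_is_diag.
- exact: toC_W spec.
- by have := spectral_card_lt spec; rewrite -/zeta; lia.
- by move=> k; exact: toC_dif_iter spec s k.
- have [P [e He]] := spectral_order spec; exists P, e.
  by rewrite /beta -cardB.
- exact: spectral_limit spec s.
- move=> delta delta0 bound.
  have := spectral_stopping spec s0 alpha1 delta0.
  by rewrite cardB.
Qed.
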